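(* Let $P$ and $P'$ be posets, with $P$ uniquely realizable, let $B_P$ be a bichain with $o(B_P)=P$ and let $B_{P'}$ be a bichain with $o(B_{P'})=P'$. Then $P$ embeds into $P'$ if and only if $B_P$ embeds into $B_{P'}$ or into $B^t_{P'}$.
   Context: A bichain is $B=(V,(\le_1,\le_2))$ with $\le_1,\le_2$ linear orders on $V$; $o(B):=(V,\le_1\cap\le_2)$; $B^t:=(V,(\le_2,\le_1))$. A realizer of a poset $P=(V,\le)$ is a set of linear orders on $V$ whose intersection is $\le$. $P$ is uniquely realizable if it has exactly one realizer of cardinality at most two (equivalently exactly two bichains $B$, namely some $B$ and $B^t$, satisfy $o(B)=P$). Embedding means isomorphism onto an induced substructure. *)

(* Defs.v *)
From Stdlib Require Import Relations Ensembles Finite_sets FinFun.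

Set Implicit Arguments.
Unset Strict Implicit.

Record poset (V : Type) := Poset {
  le : relation V;
  le_order : order V le
}.

Definition linear_order (V : Type) (L : relation V) : Prop :=
  order V L /\ forall x y : V, L x y \/ L y x.

Record bichain (V : Type) := Bichain {
  le1 : relation V;
  le2 : relation V;
  le1_linear : linear_order le1;
  le2_linear : linear_order le2
}.

Lemma inter_order (V : Type) (B : bichain V) :
  order V (fun x y => le1 B x y /\ le2 B x y).
Proof.
destruct (le1_linear B) as [[r1 t1 a1] _], (le2_linear B) as [[r2 t2 a2] _]; split.
- intro x; split; auto.
- intros x y z [h1 h2] [k1 k2]; split; eauto.
- intros x y [h1 _] [k1 _]; auto.
Qed.

Definition o (V : Type) (B : bichain V) : poset V := Poset (inter_order B).

Definition transpose (V : Type) (B : bichain V) : bichain V :=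
  Bichain (le2_linear B) (le1_linear B).

(* Realizers are nonempty: otherwise the empty family, whose intersection is the
   full relation, would be a second realizer of a poset with at most one element,
   although such a poset underlies exactly one bichain. *)
Definition realizer (V : Type) (P : poset V) (S : Ensemble (relation V)) : Prop :=
  Inhabited _ S /\
  (forall L, In _ S L -> linear_order L) /\
  (forall x y, le P x y <-> forall L, In _ S L -> L x y).

(* A realizer is a set, so a one-element realizer (P a chain) is allowed; it
   corresponds to a bichain equal to its own transpose. *)
Definition uniquely_realizable (V : Type) (P : poset V) : Prop :=
  exists! S : Ensemble (relation V),
    realizer P S /\ exists n, n <= 2 /\ cardinal _ S n.

Definition poset_embeds (V V' : Type) (P : poset V) (P' : poset V') : Prop :=
  exists f : V -> V', Injective f /\
    forall x y, le P x y <-> le P' (f x) (f y).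

Definition bichain_embeds (V V' : Type) (B : bichain V) (B' : bichain V') : Prop :=
  exists f : V -> V', Injective f /\
    (forall x y, le1 B x y <-> le1 B' (f x) (f y)) /\
    (forall x y, le2 B x y <-> le2 B' (f x) (f y)).

(* Main.v *)
From Stdlib Require Import Relations Ensembles Finite_sets FinFun Classical Lia.
Require Import Defs.

(** An embedding of [P] into [P'] pulls the two orders of [BP'] back to linear
    orders on [V] whose intersection is [P]. By unique realizability these two
    orders form the same set as the two orders of [BP], so they agree with them
    in one of the two possible matchings. *)

(** Reflexivity, transitivity and totality transfer pointwise; antisymmetry comes back through
    injectivity of [f]. *)
Lemma linear_order_pullback (V V' : Type) (f : V -> V') (L : relation V') :
  Injective f -> linear_order L -> linear_order (fun x y => L (f x) (f y)).
Proof.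
intros finj [[Lrefl Ltrans Lanti] Ltot]; split; [split|].
- intro x; apply Lrefl.
- intros x y z; apply Ltrans.
- intros x y Lxy Lyx; apply finj, Lanti; assumption.
- intros x y; apply Ltot.
Qed.

(* The case split on [a = b] spares set extensionality when computing the
   cardinal. *)
Lemma ensemble_of_pair (U : Type) (a b : U) :
  exists S : Ensemble U,
    (forall x, In _ S x <-> x = a \/ x = b) /\
    exists n, n <= 2 /\ cardinal _ S n.
Proof.
assert (in_single : forall x, In _ (Add _ (Empty_set _) a) x <-> x = a).
{ intro x; split.
  - intros [y []|y []]; reflexivity.
  - intros ->; right; constructor. }
assert (card1 : cardinal _ (Add _ (Empty_set _) a) 1).
{ apply card_add; [apply card_empty | intros []]. }
destruct (classic (a = b)) as [<-|ab].
- exists (Add _ (Empty_set _) a); split.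
  + intro x; rewrite in_single; tauto.
  + exists 1; split; [lia | exact card1].
- exists (Add _ (Add _ (Empty_set _) a) b); split.
  + intro x; split.
    * intros [y Hy|y []]; [left; apply in_single, Hy | right; reflexivity].
    * intros [->| ->]; [left; apply in_single; reflexivity | right; constructor].
  + exists 2; split; [lia | apply card_add; [exact card1|]].
    intro Hb; apply ab; symmetry; apply in_single, Hb.
Qed.

(** Describing [S] by its members covers the cases [L = M] and [L <> M] at once. *)
Lemma realizer_of_pair (V : Type) (P : poset V) (L M : relation V)
    (S : Ensemble (relation V)) :
  linear_order L -> linear_order M ->
  (forall x y, le P x y <-> L x y /\ M x y) ->
  (forall N, In _ S N <-> N = L \/ N = M) ->
  realizer P S.
Proof.
intros HL HM HP HS; split; [|split].
- exists L; apply HS; left; reflexivity.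
- intros N HN; apply HS in HN; destruct HN as [->| ->]; assumption.
- intros x y; rewrite HP; split.
  + intros [Lxy Mxy] N HN; apply HS in HN; destruct HN as [->| ->]; assumption.
  + intro Hall; split; apply Hall, HS; auto.
Qed.

(** Each pair forms a realizer with at most two elements, so both sets equal the unique one.
    Uniqueness being an equality of sets of relations, the orders come out equal, not just pointwise
    equivalent. *)
Lemma uniquely_realizable_pair (V : Type) (P : poset V)
    (L1 L2 M1 M2 : relation V) :
  uniquely_realizable P ->
  linear_order L1 -> linear_order L2 -> linear_order M1 -> linear_order M2 ->
  (forall x y, le P x y <-> L1 x y /\ L2 x y) ->
  (forall x y, le P x y <-> M1 x y /\ M2 x y) ->
  L1 = M1 /\ L2 = M2 \/ L1 = M2 /\ L2 = M1.
Proof.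
intros [S [_ uniq]] HL1 HL2 HM1 HM2 HL HM.
destruct (ensemble_of_pair _ L1 L2) as [SL [inL cardL]].
destruct (ensemble_of_pair _ M1 M2) as [SM [inM cardM]].
assert (SLM : SL = SM).
{ transitivity S; [symmetry|]; apply uniq; split; trivial.
  - exact (realizer_of_pair _ _ _ _ _ HL1 HL2 HL inL).
  - exact (realizer_of_pair _ _ _ _ _ HM1 HM2 HM inM). }
subst SM.
assert (pairs : forall N, N = L1 \/ N = L2 <-> N = M1 \/ N = M2).
{ intro N; rewrite <- inL; apply inM. }
(* Both inclusions matter: if [L1] and [L2] both equal [M1], only membership of [M2] among them
   forces [M2 = M1]. *)
destruct (proj1 (pairs L1) (or_introl eq_refl)),
  (proj1 (pairs L2) (or_intror eq_refl)),
  (proj2 (pairs M1) (or_introl eq_refl)),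
  (proj2 (pairs M2) (or_intror eq_refl)); intuition congruence.
Qed.

Lemma bichain_embeds_o (V V' : Type) (B : bichain V) (B' : bichain V') :
  bichain_embeds B B' -> poset_embeds (o B) (o B').
Proof.
intros [f [finj [f1 f2]]]; exists f; split; [exact finj|].
intros x y; simpl; rewrite f1, f2; reflexivity.
Qed.

(** Transposing swaps the conjuncts of the intersection order, which gives an equivalent relation,
    so the same map serves. *)
Lemma poset_embeds_o_transpose (V V' : Type) (P : poset V) (B' : bichain V') :
  poset_embeds P (o (transpose B')) -> poset_embeds P (o B').
Proof.
intros [f [finj fle]]; exists f; split; [exact finj|].
intros x y; rewrite fle; simpl; tauto.
Qed.

Theorem mainTheorem10 (V V' : Type) (P : poset V) (P' : poset V')
    (HP : uniquely_realizable P)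
    (BP : bichain V) (HBP : o BP = P)
    (BP' : bichain V') (HBP' : o BP' = P') :
  poset_embeds P P' <->
    bichain_embeds BP BP' \/ bichain_embeds BP (transpose BP').
Proof.
subst P P'; split.
- intros [f [finj fle]].
  (* By [fle], the pulled-back orders intersect in the order of [o BP]. The straight matching makes
     [f] an embedding into [BP'], the crossed one into its transpose. *)
  destruct (uniquely_realizable_pair _ _ _ _ _ _ HP
    (le1_linear BP) (le2_linear BP)
    (linear_order_pullback _ _ f _ finj (le1_linear BP'))
    (linear_order_pullback _ _ f _ finj (le2_linear BP'))
    (fun x y => iff_refl _) fle) as [[e1 e2]|[e1 e2]]; [left|right];
    exists f; simpl; rewrite e1, e2; repeat split; trivial.
- intros [emb|emb]; [|apply poset_embeds_o_transpose];
    apply bichain_embeds_o, emb.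
Qed.
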